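(* Let $U:[-1,1]\to\mathbb{R}$ be twice continuously differentiable, let $\alpha\in\mathbb{R}\setminus\{0\}$, $R>0$ and $\beta\in\mathbb{R}$, and suppose that $c=c_r+ic_i\in\mathbb{C}$ and a not identically zero function $\phi:[-1,1]\to\mathbb{C}$ satisfy $$(U-c)(D^2-\alpha^2)\phi-(D^2U-\beta)\phi=\frac{1}{i\alpha R}(D^2-\alpha^2)^2\phi\quad\text{on }[-1,1],\qquad \phi=D\phi=0\ \text{ at } z=\pm1 .$$ Write $U_{\min},U_{\max}$ for the minimum and maximum of $U$ on $[-1,1]$, and $D^2U_{\min},D^2U_{\max}$ for the minimum and maximum of the function $D^2U$ on $[-1,1]$. Then: (i) If $\frac{D^2U_{\min}}{2}\ge\beta$, then $$U_{\min}<c_r<U_{\max}+\frac{4\left(\frac{D^2U_{\max}}{2}-\beta\right)}{\pi^2+4\alpha^2}.$$ (ii) If $\frac{D^2U_{\min}}{2}\le\beta\le\frac{D^2U_{\max}}{2}$, then $$U_{\min}+\frac{4\left(\frac{D^2U_{\min}}{2}-\beta\right)}{\pi^2+4\alpha^2}<c_r<U_{\max}+\frac{4\left(\frac{D^2U_{\max}}{2}-\beta\right)}{\pi^2+4\alpha^2}.$$ (iii) If $\frac{D^2U_{\max}}{2}\le\beta$, then $$U_{\min}+\frac{4\left(\frac{D^2U_{\min}}{2}-\beta\right)}{\pi^2+4\alpha^2}<c_r<U_{\max}.$$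
   Context: Here $D=d/dz$ is differentiation with respect to the real variable $z\in[-1,1]$, $(D^2-\alpha^2)\phi=\phi''-\alpha^2\phi$, and $(D^2-\alpha^2)^2\phi=\phi''''-2\alpha^2\phi''+\alpha^4\phi$. The function $\phi$ is complex valued and is a classical solution. $c_r$ and $c_i$ are the real and imaginary parts of $c$. This is the eigenvalue problem for the linear stability of an incompressible viscous parallel shear flow with basic velocity distribution $U$ in the $\beta$-plane, with wave number $\alpha$, Reynolds number $R$, complex wave velocity $c$, and $\beta$ the derivative of the Coriolis force in the latitudinal direction.
   Formalization: The case where U is constant on [-1,1] and β = 0 is excluded, since there every eigenvalue has c_r = U_min = U_max and the strict inequalities of (i)–(iii) fail. *)

(* Defs.v *)
From Stdlib Require Import Reals Lra.
From Coquelicot Require Import Coquelicot.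
Open Scope R_scope.

Definition I11 (z : R) : Prop := -1 <= z <= 1.

(* [f'] is the derivative of [f] relative to the set [D]: same as [is_derive],
   with [locally x] replaced by its trace on [D].  When [D] is a closed
   interval this is the ordinary derivative at interior points and the
   one-sided derivative at the endpoints; the values of [f] and [f'] outside
   [D] are irrelevant. *)
Definition is_derive_on {V : NormedModule R_AbsRing} (D : R -> Prop)
    (f f' : R -> V) : Prop :=
  forall x : R, D x ->
    filterdiff f (within D (locally x)) (fun y : R => scal y (f' x)).

Definition is_min_on (D : R -> Prop) (f : R -> R) (m : R) : Prop :=
  (exists x, D x /\ f x = m) /\ (forall x, D x -> m <= f x).

Definition is_max_on (D : R -> Prop) (f : R -> R) (m : R) : Prop :=
  (exists x, D x /\ f x = m) /\ (forall x, D x -> f x <= m).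

(* Main.v *)
Require Import Defs.
From Stdlib Require Import Reals Lra Psatz.
From Coquelicot Require Import Coquelicot.
Open Scope R_scope.

(** Multiply the equation by the conjugate of [phi], integrate by parts and take real parts: the
    viscous terms drop out and, with [N = |phi|^2] and [E = |phi'|^2 + alpha^2 N],
      [c_r * int E = int U E + int (U''/2 - beta) N].
    Bounding [U] and [U''] by their extrema and using the Poincare inequality
    [int E >= (PI^2/4 + alpha^2) int N] gives the bounds with weak inequalities.  They are strict
    because Poincare's inequality is an equality only for multiples of [cos (PI z / 2)], which are
    excluded by [phi' = 0] at the ends.  When the coefficient of [N] has the sign
    that makes Poincare's inequality unnecessary, equality would force [U = c_r] and
    [U'' = 2 beta] wherever [phi <> 0]; by uniqueness for the linear equation this set is
    dense, so [U] would be constant and [beta = 0].  Lower bounds are upper bounds for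
    [(-U, -beta, -c_r)]. *)

(** * Calculus on [-1,1] *)

Definition clamp (z : R) : R := Rmax (-1) (Rmin 1 z).

Lemma clamp_I11 z : I11 (clamp z).
Proof.
unfold clamp, I11, Rmax, Rmin.
destruct (Rle_dec 1 z); destruct (Rle_dec _ _); lra.
Qed.

Lemma clamp_id z : I11 z -> clamp z = z.
Proof.
unfold clamp, I11, Rmax, Rmin; intros H.
destruct (Rle_dec 1 z); destruct (Rle_dec _ _); lra.
Qed.

Lemma clamp_dist x y : Rabs (clamp y - clamp x) <= Rabs (y - x).
Proof.
unfold clamp, Rmax, Rmin.
destruct (Rle_dec 1 x); destruct (Rle_dec 1 y);
  repeat match goal with |- context [Rle_dec ?a ?b] => destruct (Rle_dec a b) end;
  unfold Rabs;
  repeat match goal with |- context [Rcase_abs ?a] => destruct (Rcase_abs a) end; lra.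
Qed.

Lemma interior_I11 x : -1 < x < 1 -> I11 x.
Proof. unfold I11; lra. Qed.

Lemma locally_interior x : -1 < x < 1 -> locally x (fun y => -1 < y < 1).
Proof.
intros Hx.
apply (open_and (fun y => -1 < y) (fun y => y < 1)); [apply open_gt | apply open_lt | exact Hx].
Qed.

(* Continuity of [f] on [-1,1]; precomposing with [clamp] makes the values of [f] outside
   [-1,1] irrelevant and the endpoints interior points. *)
Definition contI (f : R -> R) : Prop :=
  forall x, continuous (fun z => f (clamp z)) x.

Lemma contI_of_continuous_on f : continuous_on I11 f -> contI f.
Proof.
intros Hf x.
unfold continuous.
apply (filterlim_comp _ _ _ clamp f _ (within I11 (locally (clamp x))) _).
(* Since [clamp] is 1-Lipschitz with values in [-1,1], the same radius serves for the trace of the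
   neighbourhood. *)
- intros P [d Hd]; exists d; intros y Hy.
  apply Hd; [|apply clamp_I11].
  apply Rle_lt_trans with (2 := Hy), clamp_dist.
- apply Hf, clamp_I11.
Qed.

Lemma contI_of_continuous f : (forall x, continuous f x) -> contI f.
Proof.
intros Hf; apply contI_of_continuous_on; intros x _.
apply filterlim_filter_le_1 with (2 := Hf x).
intros P HP; unfold within; now apply filter_imp with (2 := HP).
Qed.

Lemma contI_const a : contI (fun _ => a).
Proof. intros x; apply continuous_const. Qed.

Lemma contI_plus f g : contI f -> contI g -> contI (fun z => f z + g z).
Proof.
intros Hf Hg x.
exact (continuous_plus (fun z => f (clamp z)) (fun z => g (clamp z)) x (Hf x) (Hg x)).
Qed.

Lemma contI_opp f : contI f -> contI (fun z => - f z).
Proof.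
intros Hf x.
exact (continuous_opp (fun z => f (clamp z)) x (Hf x)).
Qed.

Lemma contI_minus f g : contI f -> contI g -> contI (fun z => f z - g z).
Proof. intros Hf Hg; apply contI_plus; [|apply contI_opp]; assumption. Qed.

Lemma contI_mult f g : contI f -> contI g -> contI (fun z => f z * g z).
Proof.
intros Hf Hg x.
exact (continuous_mult (fun z => f (clamp z)) (fun z => g (clamp z)) x (Hf x) (Hg x)).
Qed.

Lemma contI_pow f n : contI f -> contI (fun z => f z ^ n).
Proof.
intros Hf; induction n as [|n IH]; simpl; [apply contI_const|].
now apply (contI_mult f (fun z => f z ^ n)).
Qed.

Lemma contI_exp a : contI (fun z => exp (a * z)).
Proof.
apply contI_of_continuous; intros x.
apply continuous_exp_comp.
apply (continuous_mult (fun _ => a) (fun z => z)); [apply continuous_const | apply continuous_id].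
Qed.

Ltac contI :=
  lazymatch goal with
  | |- contI (fun _ => ?a) => apply (contI_const a)
  | |- contI (fun z => @?f z + @?g z) => apply (contI_plus f g); contI
  | |- contI (fun z => @?f z - @?g z) => apply (contI_minus f g); contI
  | |- contI (fun z => - @?f z) => apply (contI_opp f); contI
  | |- contI (fun z => @?f z * @?g z) => apply (contI_mult f g); contI
  | |- contI (fun z => @?f z / ?a) => apply (contI_mult f (fun _ => / a)); contI
  | |- contI (fun z => @?f z ^ ?n) => apply (contI_pow f n); contI
  | |- _ => assumption
  end.

(** * Mean value theorem, monotonicity and Gronwall's inequality *)

(** Apply the classical theorem to [F] composed with [clamp]: it is continuous everywhere and agrees
    with [F] near each interior point, so differentiability is only asked inside. *)
Lemma mean_value (F F' : R -> R) a b :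
  contI F -> (forall x, -1 < x < 1 -> is_derive F x (F' x)) ->
  -1 <= a -> a < b -> b <= 1 ->
  exists x, a < x < b /\ F b - F a = F' x * (b - a).
Proof.
intros HF HF' Ha Hab Hb.
assert (pr1 : forall x, a < x < b -> derivable_pt (fun z => F (clamp z)) x).
{ intros x Hx; exists (F' x); apply is_derive_Reals.
  apply is_derive_ext_loc with F; [|apply HF'; lra].
  apply filter_imp with (2 := locally_interior x ltac:(lra)).
  intros y Hy; now rewrite clamp_id by (unfold I11; lra). }
assert (pr2 : forall x, a < x < b -> derivable_pt id x) by (intros; apply derivable_pt_id).
(* Cauchy's two-function form; taking [id] as the second function gives Lagrange's. *)
destruct (MVT (fun z => F (clamp z)) id a b pr1 pr2 Hab) as [x [Hx Heq]].
- intros x _; apply continuity_pt_filterlim, HF.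
- intros x _; apply derivable_continuous_pt, derivable_pt_id.
- exists x; split; [exact Hx|].
  rewrite !clamp_id in Heq by (unfold I11; lra).
  rewrite (derive_pt_eq_0 id x 1 (pr2 x Hx) (derivable_pt_lim_id x)) in Heq.
  rewrite (derive_pt_eq_0 _ x (F' x) (pr1 x Hx)) in Heq; [unfold id in Heq; lra|].
  apply is_derive_Reals.
  apply is_derive_ext_loc with F; [|apply HF'; lra].
  apply filter_imp with (2 := locally_interior x ltac:(lra)).
  intros y Hy; now rewrite clamp_id by (unfold I11; lra).
Qed.

Lemma derive_zero_constant (F F' : R -> R) x y :
  contI F -> (forall z, -1 < z < 1 -> is_derive F z (F' z)) ->
  (forall z, -1 < z < 1 -> F' z = 0) -> I11 x -> I11 y -> F x = F y.
Proof.
unfold I11; intros HF HF' H0 Hx Hy.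
destruct (Rtotal_order x y) as [H|[->|H]]; [|easy|].
- destruct (mean_value F F' x y HF HF') as [z [Hz E]]; try lra.
  rewrite H0 in E; lra.
- destruct (mean_value F F' y x HF HF') as [z [Hz E]]; try lra.
  rewrite H0 in E; lra.
Qed.

Lemma derive_nonneg_increasing (F F' : R -> R) x y :
  contI F -> (forall z, -1 < z < 1 -> is_derive F z (F' z)) ->
  (forall z, -1 < z < 1 -> 0 <= F' z) -> -1 <= x -> x <= y -> y <= 1 -> F x <= F y.
Proof.
intros HF HF' H0 Hx Hxy Hy.
destruct (Req_dec x y) as [->|H]; [lra|].
destruct (mean_value F F' x y HF HF') as [z [Hz E]]; try lra.
assert (0 <= F' z * (y - x)); [|lra].
apply Rmult_le_pos; [apply H0|]; lra.
Qed.

(** Inside, [f] is locally 0 and so has derivative 0; it is therefore constant up to the ends. *)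
Lemma contI_zero_ends f x :
  contI f -> (forall z, -1 < z < 1 -> f z = 0) -> I11 x -> f x = 0.
Proof.
intros Hf H0 Hx.
rewrite <- (H0 0) by lra.
apply (derive_zero_constant f (fun _ => 0)); unfold I11; auto; try lra.
intros z Hz; apply is_derive_ext_loc with (fun _ => 0); [|apply is_derive_Reals, derivable_pt_lim_const].
apply filter_imp with (2 := locally_interior z Hz).
intros y Hy; now rewrite H0.
Qed.

(** The bound on [F'] makes [exp (- K * z) * F z] nonincreasing and [exp (K * z) * F z]
    nondecreasing. The first forces [F] to vanish to the right of [x0], the second to its left. *)
Lemma gronwall (F F' : R -> R) K x0 x :
  contI F -> (forall z, -1 < z < 1 -> is_derive F z (F' z)) ->
  (forall z, -1 < z < 1 -> Rabs (F' z) <= K * F z) ->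
  (forall z, 0 <= F z) -> I11 x0 -> F x0 = 0 -> I11 x -> F x = 0.
Proof.
unfold I11; intros HF HF' HK Hpos Hx0 E0 Hx.
apply Rle_antisym; [|apply Hpos].
assert (D : forall a z, -1 < z < 1 ->
  is_derive (fun z => exp (a * z) * F z) z (exp (a * z) * (a * F z + F' z))).
{ intros a z Hz.
  evar_last.
  - apply (is_derive_mult (fun z => exp (a * z)) F z (a * exp (a * z)) (F' z));
      [auto_derive; [easy|ring]|now apply HF'|apply Rmult_comm].
  - unfold plus, mult; simpl; ring. }
assert (C : forall a, contI (fun z => exp (a * z) * F z)).
{ intros a; apply contI_mult; [apply contI_exp|exact HF]. }
destruct (Rle_dec x0 x) as [H|H].
- assert (- (exp (- K * x0) * F x0) <= - (exp (- K * x) * F x)).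
  { apply (derive_nonneg_increasing (fun z => - (exp (- K * z) * F z))
      (fun z => - (exp (- K * z) * (- K * F z + F' z)))); try lra.
    - apply contI_opp, C.
    - intros z Hz; apply (is_derive_opp (fun z => exp (- K * z) * F z)), D, Hz.
    - intros z Hz; specialize (HK z Hz); apply Rabs_le_between in HK.
      assert (0 <= exp (- K * z) * (K * F z - F' z)); [|lra].
      apply Rmult_le_pos; [apply Rlt_le, exp_pos|lra]. }
  pose proof (exp_pos (- K * x)); rewrite E0 in *; nra.
- assert (exp (K * x) * F x <= exp (K * x0) * F x0).
  { apply (derive_nonneg_increasing (fun z => exp (K * z) * F z)
      (fun z => exp (K * z) * (K * F z + F' z))); try lra.
    - apply C.
    - intros z Hz; apply D, Hz.
    - intros z Hz; specialize (HK z Hz); apply Rabs_le_between in HK.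
      apply Rmult_le_pos; [apply Rlt_le, exp_pos|lra]. }
  pose proof (exp_pos (K * x)); rewrite E0 in *; nra.
Qed.

(** * Integration over [-1,1] *)

(** With [clamp] the integrand is continuous on the whole line whenever [contI g] holds, so its
    primitive is differentiable everywhere, the endpoints included. *)
Definition integralI (g : R -> R) : R := RInt (fun z => g (clamp z)) (-1) 1.

Lemma ex_RInt_clamp g a b : contI g -> ex_RInt (fun z => g (clamp z)) a b.
Proof. intros Hg; apply (ex_RInt_continuous (V := R_CompleteNormedModule)); intros z _; apply Hg. Qed.

Lemma is_derive_primitive g x :
  contI g -> is_derive (fun b => RInt (fun z => g (clamp z)) (-1) b) x (g (clamp x)).
Proof.
intros Hg.
apply (is_derive_RInt (fun z => g (clamp z)) _ (-1)); [|apply Hg].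
apply filter_forall; intros b.
apply (RInt_correct (V := R_CompleteNormedModule)), ex_RInt_clamp, Hg.
Qed.

(** [F] minus the primitive of [g] is continuous up to the ends and has zero derivative inside, so
    it is constant. *)
Lemma integralI_derive (F g : R -> R) :
  contI F -> contI g -> (forall z, -1 < z < 1 -> is_derive F z (g z)) ->
  integralI g = F 1 - F (-1).
Proof.
intros HF Hg HD.
pose (A b := RInt (fun z => g (clamp z)) (-1) b).
assert (E : F 1 - A 1 = F (-1) - A (-1)).
{ apply (derive_zero_constant (fun z => F z - A z) (fun z => g z - g (clamp z)));
    unfold I11; try lra.
  - apply contI_minus; [exact HF|].
    apply contI_of_continuous; intros x.
    apply (ex_derive_continuous A); eexists; now apply is_derive_primitive.
  - intros z Hz; apply (is_derive_minus F A); [now apply HD|now apply is_derive_primitive].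
  - intros z Hz; rewrite clamp_id; unfold I11; lra. }
unfold integralI; fold (A 1).
assert (A (-1) = 0) by (unfold A; now rewrite RInt_point).
lra.
Qed.

Lemma integralI_ext f g : (forall z, -1 < z < 1 -> f z = g z) -> integralI f = integralI g.
Proof.
intros H; apply RInt_ext; intros x.
rewrite Rmin_left, Rmax_right by lra; intros Hx.
rewrite clamp_id by (unfold I11; lra); now apply H.
Qed.

Lemma integralI_plus f g : contI f -> contI g -> integralI (fun z => f z + g z) = integralI f + integralI g.
Proof.
intros Hf Hg.
apply (RInt_plus (V := R_CompleteNormedModule)); now apply ex_RInt_clamp.
Qed.

Lemma integralI_scal k f : contI f -> integralI (fun z => k * f z) = k * integralI f.
Proof.
intros Hf.
apply (RInt_scal (V := R_CompleteNormedModule)); now apply ex_RInt_clamp.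
Qed.

Lemma integralI_le f g :
  contI f -> contI g -> (forall z, -1 < z < 1 -> f z <= g z) -> integralI f <= integralI g.
Proof.
intros Hf Hg H.
apply RInt_le; [lra| now apply ex_RInt_clamp..|].
intros x Hx; rewrite clamp_id by (unfold I11; lra); now apply H.
Qed.

Lemma integralI_zero : integralI (fun _ => 0) = 0.
Proof. unfold integralI; rewrite RInt_const; unfold scal; simpl; unfold mult; simpl; ring. Qed.

(** The primitive of [g] increases from 0 to a value at most 0, so it vanishes, and so does its
    derivative [g]. *)
Lemma integralI_nonneg_eq_0 g x :
  contI g -> (forall z, -1 < z < 1 -> 0 <= g z) -> integralI g <= 0 -> I11 x -> g x = 0.
Proof.
intros Hg Hpos H0 Hx.
apply contI_zero_ends; [exact Hg| |exact Hx]; clear x Hx.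
pose (A b := RInt (fun z => g (clamp z)) (-1) b).
assert (HD : forall z, -1 < z < 1 -> is_derive A z (g z)).
{ intros z Hz; rewrite <- (clamp_id z) at 2 by (unfold I11; lra); now apply is_derive_primitive. }
assert (HA : contI A).
{ apply contI_of_continuous; intros x.
  apply (ex_derive_continuous A); eexists; now apply is_derive_primitive. }
assert (E1 : A (-1) = 0) by (unfold A; now rewrite RInt_point).
assert (E : forall z, -1 < z < 1 -> A z = 0).
{ intros z Hz.
  assert (A (-1) <= A z) by (apply (derive_nonneg_increasing A g); auto; lra).
  assert (A z <= A 1) by (apply (derive_nonneg_increasing A g); auto; lra).
  change (A 1 <= 0) in H0; lra. }
intros x Hx.
rewrite <- (is_derive_unique A x (g x)) by now apply HD.
apply is_derive_unique, is_derive_ext_loc with (fun _ => 0).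
- apply filter_imp with (2 := locally_interior x Hx).
  intros y Hy; now rewrite E.
- apply is_derive_Reals, derivable_pt_lim_const.
Qed.

(** * From derivatives relative to [-1,1] to ordinary ones *)

(** [filterdiff] states its estimate at every limit point of the filter; this allows it to be used
    at [x]. *)
Lemma within_I11_lim x : I11 x -> is_filter_lim (within I11 (locally x)) x.
Proof. intros _ P HP; unfold within; now apply filter_imp with (2 := HP). Qed.

Lemma is_derive_on_Re phi phi' :
  is_derive_on (V := C_R_NormedModule) I11 phi phi' ->
  is_derive_on (V := R_NormedModule) I11 (fun z => Re (phi z)) (fun z => Re (phi' z)).
Proof.
intros H x Hx.
apply (filterdiff_comp (U := R_NormedModule) (V := C_R_NormedModule) phi Re
  (fun y => scal y (phi' x)) Re (H x Hx)).
apply (filterdiff_linear (U := C_R_NormedModule) (V := R_NormedModule) Re).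
apply (is_linear_fst (U := R_NormedModule) (V := R_NormedModule)).
Qed.

Lemma is_derive_on_Im phi phi' :
  is_derive_on (V := C_R_NormedModule) I11 phi phi' ->
  is_derive_on (V := R_NormedModule) I11 (fun z => Im (phi z)) (fun z => Im (phi' z)).
Proof.
intros H x Hx.
apply (filterdiff_comp (U := R_NormedModule) (V := C_R_NormedModule) phi Im
  (fun y => scal y (phi' x)) Im (H x Hx)).
apply (filterdiff_linear (U := C_R_NormedModule) (V := R_NormedModule) Im).
apply (is_linear_snd (U := R_NormedModule) (V := R_NormedModule)).
Qed.

(** Near an interior point every point lies in [-1,1], so restricting the neighbourhood filter
    changes nothing. *)
Lemma is_derive_on_interior (f f' : R -> R) x :
  is_derive_on (V := R_NormedModule) I11 f f' -> -1 < x < 1 -> is_derive f x (f' x).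
Proof.
intros H Hx.
destruct (H x (interior_I11 x Hx)) as [Hl Hd]; split; [exact Hl|].
intros y Hy eps.
assert (Hy' : is_filter_lim (within I11 (locally x)) y).
{ intros P HP; unfold within; now apply filter_imp with (2 := Hy P HP). }
generalize (filter_and _ _ (locally_interior x Hx) (Hd y Hy' eps)).
apply filter_imp; intros z [Hz Hb]; now apply Hb, interior_I11.
Qed.

Lemma is_derive_on_bound (f f' : R -> R) x eps :
  is_derive_on (V := R_NormedModule) I11 f f' -> I11 x -> 0 < eps ->
  locally x (fun y => I11 y -> Rabs (f y - f x - (y - x) * f' x) <= eps * Rabs (y - x)).
Proof.
intros H Hx He.
destruct (H x Hx) as [_ Hd].
exact (Hd x (within_I11_lim x Hx) (mkposreal eps He)).
Qed.

Lemma is_derive_on_contI (f f' : R -> R) :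
  is_derive_on (V := R_NormedModule) I11 f f' -> contI f.
Proof.
intros H; apply contI_of_continuous_on; intros x Hx.
apply (filterdiff_continuous_aux (U := R_NormedModule) (V := R_NormedModule)).
- eexists; now apply H.
- now apply within_I11_lim.
Qed.

(** * The Poincare inequality *)

(* At the endpoints the cosine vanishes and Rocq gives the quotient the value [0], which is
   its limit because [f] vanishes there to second order. *)
Lemma contI_quotient_cos (f f' : R -> R) :
  is_derive_on (V := R_NormedModule) I11 f f' ->
  f (-1) = 0 -> f 1 = 0 -> f' (-1) = 0 -> f' 1 = 0 ->
  contI (fun z => f z / cos (PI / 2 * z)).
Proof.
intros H fm fp f'm f'p; apply contI_of_continuous_on.
(* At an endpoint the cosine has a simple zero with slope [d], while [f y] is of smaller order than
   [y - x]. *)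
assert (End : forall x d, I11 x -> f x = 0 -> f' x = 0 -> d <> 0 ->
  cos (PI / 2 * x) = 0 -> is_derive (fun z => cos (PI / 2 * z)) x d ->
  filterlim (fun z => f z / cos (PI / 2 * z)) (within I11 (locally x))
    (locally (f x / cos (PI / 2 * x)))).
{ intros x d Hx E E' Hd Ec Dc.
  replace (f x / cos (PI / 2 * x)) with 0 by (rewrite E; unfold Rdiv; ring).
  apply filterlim_locally; intros [eps He]; simpl.
  assert (Hd' : 0 < Rabs d) by now apply Rabs_pos_lt.
  (* These tolerances give [|f y| <= eps |d| / 4 |y - x|] and [|cos| >= |d| / 2 |y - x|], hence a
     quotient of at most [eps / 2]. *)
  assert (He1 : 0 < eps * Rabs d / 4) by nra.
  assert (He2 : 0 < Rabs d / 2) by lra.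
  destruct Dc as [_ Dc].
  generalize (filter_and _ _ (is_derive_on_bound f f' x _ H Hx He1)
    (Dc x (fun P HP => HP) (mkposreal _ He2))).
  unfold within; apply filter_imp; simpl.
  intros y [H1 H2] Hy; specialize (H1 Hy).
  unfold norm, minus, plus, opp, scal in H2; simpl in H2; unfold abs, mult in H2; simpl in H2.
  rewrite Ec, E, E' in *.
  unfold ball; simpl; unfold AbsRing_ball, abs, minus, plus, opp; simpl.
  rewrite Ropp_0, Rplus_0_r.
  destruct (Req_dec y x) as [->|Hyx].
  { rewrite E; unfold Rdiv; rewrite Rmult_0_l, Rabs_R0; exact He. }
  assert (Hr : 0 < Rabs (y - x)) by (apply Rabs_pos_lt; lra).
  set (w := cos (PI / 2 * y)) in *.
  assert (Hw : Rabs d / 2 * Rabs (y - x) <= Rabs w).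
  { assert (T : Rabs ((y - x) * d) <= Rabs w + Rabs (w + - 0 + - ((y + - x) * d))).
    { replace ((y - x) * d) with (w - (w + - 0 + - ((y + - x) * d))) by ring.
      unfold Rminus at 1; rewrite <- (Rabs_Ropp (w + - 0 + - ((y + - x) * d))).
      apply Rabs_triang. }
    rewrite Rabs_mult in T; change (y + - x) with (y - x) in *; nra. }
  replace (f y - 0 - (y - x) * 0) with (f y) in H1 by ring.
  assert (Hw0 : 0 < Rabs w) by nra.
  unfold Rdiv; rewrite Rabs_mult, Rabs_inv.
  apply Rmult_lt_reg_r with (Rabs w); [exact Hw0|].
  rewrite Rmult_assoc, Rinv_l, Rmult_1_r by lra.
  apply Rle_lt_trans with (1 := H1).
  apply Rlt_le_trans with (eps * (Rabs d / 2 * Rabs (y - x))); nra. }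
intros x Hx.
assert (Dc : is_derive (fun z => cos (PI / 2 * z)) x (- sin (PI / 2 * x) * (PI / 2)))
  by (auto_derive; [easy|ring]).
pose proof PI_RGT_0.
destruct (Req_dec x 1) as [->|H1]; [|destruct (Req_dec x (-1)) as [->|H2]].
- apply (End 1 (- sin (PI / 2 * 1) * (PI / 2))); auto; rewrite Rmult_1_r.
  + rewrite sin_PI2; lra.
  + apply cos_PI2.
- apply (End (-1) (- sin (PI / 2 * -1) * (PI / 2))); auto;
    replace (PI / 2 * -1) with (- (PI / 2)) by ring.
  + rewrite sin_neg, sin_PI2; lra.
  + rewrite cos_neg; apply cos_PI2.
- assert (Hi : -1 < x < 1) by (unfold I11 in Hx; lra).
  assert (Hc : 0 < cos (PI / 2 * x)) by (apply cos_gt_0; nra).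
  assert (Hq : continuous (fun z => f z / cos (PI / 2 * z)) x).
  { apply (ex_derive_continuous (fun z => f z / cos (PI / 2 * z))).
    apply ex_derive_div.
    - eexists; now apply is_derive_on_interior with (1 := H).
    - eexists; apply Dc.
    - lra. }
  apply filterlim_filter_le_1 with (2 := Hq).
  intros P HP; unfold within; now apply filter_imp with (2 := HP).
Qed.

(* With [q = f / cos (PI/2 z)] one has
   [f'^2 - (PI/2)^2 f^2 = (cos (PI/2 z) q')^2 - ((PI/2) tan (PI/2 z) f^2)']. *)
Lemma poincare_strict (f f' : R -> R) :
  is_derive_on (V := R_NormedModule) I11 f f' -> contI f' ->
  f (-1) = 0 -> f 1 = 0 -> f' (-1) = 0 -> f' 1 = 0 ->
  0 <= integralI (fun z => f' z ^ 2 - (PI / 2) ^ 2 * f z ^ 2) /\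
  (integralI (fun z => f' z ^ 2 - (PI / 2) ^ 2 * f z ^ 2) <= 0 -> forall x, I11 x -> f x = 0).
Proof.
intros H Cf' fm fp f'm f'p.
pose proof PI_RGT_0 as HPI.
pose proof (is_derive_on_contI _ _ H) as Cf.
pose proof (contI_quotient_cos f f' H fm fp f'm f'p) as Cq.
set (q := fun z => f z / cos (PI / 2 * z)) in *.
assert (Cs : contI (fun z => sin (PI / 2 * z))).
{ apply contI_of_continuous; intros x.
  apply (ex_derive_continuous (fun z => sin (PI / 2 * z))); auto_derive; easy. }
(* [h] is [cos (PI/2 z) q'], written without [q'] so that it is visibly continuous up to the
   ends. *)
set (h := fun z => f' z + PI / 2 * (sin (PI / 2 * z) * q z)).
assert (Ch : contI h) by (unfold h; contI).
assert (Hc : forall z, -1 < z < 1 -> 0 < cos (PI / 2 * z)).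
{ intros z Hz; apply cos_gt_0; nra. }
assert (D : forall z, -1 < z < 1 ->
  is_derive q z (h z / cos (PI / 2 * z))).
{ intros z Hz; pose proof (Hc z Hz).
  evar_last.
  - apply is_derive_div with (df := f' z) (dg := - sin (PI / 2 * z) * (PI / 2)).
    + now apply is_derive_on_interior with (1 := H).
    + auto_derive; [easy|ring].
    + lra.
  - unfold h, q; field; lra. }
assert (E : integralI (fun z => f' z ^ 2 - (PI / 2) ^ 2 * f z ^ 2) = integralI (fun z => h z ^ 2)).
(* The difference of the integrands is the derivative of [(PI/2) tan (PI/2 z) f^2]; writing it as
   [PI/2 sin (PI/2 z) f q] makes it continuous up to the ends, where it vanishes with [f]. *)
{ set (g := fun z => h z ^ 2 + -1 * (f' z ^ 2 - (PI / 2) ^ 2 * f z ^ 2)).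
  assert (Z : integralI g = PI / 2 * (sin (PI / 2 * 1) * (f 1 * q 1))
                    - PI / 2 * (sin (PI / 2 * -1) * (f (-1) * q (-1)))).
  { apply (integralI_derive (fun z => PI / 2 * (sin (PI / 2 * z) * (f z * q z))) g).
    - contI.
    - unfold g; contI.
    - intros z Hz; pose proof (Hc z Hz).
      pose proof (is_derive_on_interior f f' z H Hz) as Df.
      pose proof (D z Hz) as Dq.
      evar_last.
      + auto_derive.
        * split; [eexists; exact Df|split; [eexists; exact Dq|easy]].
        * reflexivity.
      + replace (Derive (fun x => f x) z) with (f' z)
          by (symmetry; now apply is_derive_unique).
        replace (Derive (fun x => q x) z) with (h z / cos (PI / 2 * z))
          by (symmetry; now apply is_derive_unique).
        assert (Ef : f z = q z * cos (PI / 2 * z)) by (unfold q; field; lra).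
        unfold g, h; rewrite !Ef; field; lra. }
  unfold g in Z; rewrite integralI_plus, integralI_scal in Z by contI.
  rewrite fp, fm in Z; lra. }
rewrite E; split.
- rewrite <- integralI_zero; apply integralI_le; [contI|contI|].
  intros z _; apply pow2_ge_0.
- intros H0 x Hx.
  assert (Zh : forall z, I11 z -> h z = 0).
  { intros z Hz.
    assert (h z ^ 2 = 0).
    { apply (integralI_nonneg_eq_0 (fun z => h z ^ 2)); [contI| |exact H0|exact Hz].
      intros y _; apply pow2_ge_0. }
    nra. }
  apply contI_zero_ends; [exact Cf| |exact Hx].
  intros z Hz.
  (* As [h = 0], [q] is constant on the closed interval. Its value at 1 is 0 because the numerator
     [f 1] is 0; continuity of [q] there is what excludes the cosine itself. *)
  assert (Eq : q z = q 1).
  { apply (derive_zero_constant q (fun z => h z / cos (PI / 2 * z))); unfold I11; auto; try lra.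
    intros y Hy; rewrite Zh by (unfold I11; lra); apply Rmult_0_l. }
  assert (Q1 : q 1 = 0) by (unfold q; rewrite fp; apply Rmult_0_l).
  pose proof (Hc z Hz).
  assert (Ef : f z = q z * cos (PI / 2 * z)) by (unfold q; field; lra).
  rewrite Ef, Eq, Q1; ring.
Qed.

(** * Uniqueness for the linear equation *)

Lemma contI_bounded f : contI f -> exists K, 0 <= K /\ forall x, I11 x -> Rabs (f x) <= K.
Proof.
intros Hf.
destruct (continuity_ab_maj (fun z => Rabs (f (clamp z))) (-1) 1) as [m [Hm _]]; [lra| |].
- intros x _; apply continuity_pt_filterlim.
  apply (continuous_comp (fun z => f (clamp z)) Rabs); [apply Hf|apply continuous_Rabs].
- exists (Rabs (f (clamp m))); split; [apply Rabs_pos|].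
  intros x Hx; rewrite <- (clamp_id x Hx) at 1; now apply Hm.
Qed.

(** Bounds the terms that appear when the highest derivative is replaced by a linear combination. *)
Lemma abs_mult_le u a K y : Rabs a <= K -> 2 * Rabs (u * (a * y)) <= K * (u ^ 2 + y ^ 2).
Proof.
intros Ha; rewrite !Rabs_mult, <- (pow2_abs u), <- (pow2_abs y).
pose proof (Rabs_pos u); pose proof (Rabs_pos y); pose proof (Rabs_pos a).
assert (0 <= Rabs u * Rabs y) by nra.
apply Rle_trans with (K * (2 * (Rabs u * Rabs y))); [nra|].
apply Rmult_le_compat_l; [lra|].
pose proof (pow2_ge_0 (Rabs u - Rabs y)); nra.
Qed.

Lemma is_derive_sq (f : R -> R) x d : is_derive f x d -> is_derive (fun z => f z ^ 2) x (2 * (f x * d)).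
Proof.
intros H; evar_last; [apply (is_derive_pow f 2 x d H)|simpl; ring].
Qed.

Ltac is_derive_sum_sq :=
  lazymatch goal with
  | |- is_derive (fun z => @?f z + @?g z) _ _ =>
      apply (is_derive_plus (V := R_NormedModule) f g); is_derive_sum_sq
  | |- is_derive (fun z => @?f z ^ 2) _ _ =>
      apply (is_derive_sq f)
  end.

(** The sum [F] of the squares of the eight unknowns satisfies [|F'| <= K F] because the
    coefficients are bounded, and it vanishes at [x0]; Gronwall's inequality concludes. *)
Lemma linear_system_zero (f f1 f2 f3 f4 g g1 g2 g3 g4 a1 a2 a3 a4 b1 b2 b3 b4 : R -> R) x0 :
  (forall z, -1 < z < 1 -> is_derive f z (f1 z)) ->
  (forall z, -1 < z < 1 -> is_derive f1 z (f2 z)) ->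
  (forall z, -1 < z < 1 -> is_derive f2 z (f3 z)) ->
  (forall z, -1 < z < 1 -> is_derive f3 z (f4 z)) ->
  (forall z, -1 < z < 1 -> is_derive g z (g1 z)) ->
  (forall z, -1 < z < 1 -> is_derive g1 z (g2 z)) ->
  (forall z, -1 < z < 1 -> is_derive g2 z (g3 z)) ->
  (forall z, -1 < z < 1 -> is_derive g3 z (g4 z)) ->
  contI f -> contI f1 -> contI f2 -> contI f3 ->
  contI g -> contI g1 -> contI g2 -> contI g3 ->
  contI a1 -> contI a2 -> contI a3 -> contI a4 ->
  contI b1 -> contI b2 -> contI b3 -> contI b4 ->
  (forall z, -1 < z < 1 -> f4 z = a1 z * f z + a2 z * g z + a3 z * f2 z + a4 z * g2 z) ->
  (forall z, -1 < z < 1 -> g4 z = b1 z * f z + b2 z * g z + b3 z * f2 z + b4 z * g2 z) ->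
  I11 x0 -> f x0 = 0 -> f1 x0 = 0 -> f2 x0 = 0 -> f3 x0 = 0 ->
  g x0 = 0 -> g1 x0 = 0 -> g2 x0 = 0 -> g3 x0 = 0 ->
  forall x, I11 x -> f x = 0 /\ g x = 0.
Proof.
intros Df Df1 Df2 Df3 Dg Dg1 Dg2 Dg3 Cf Cf1 Cf2 Cf3 Cg Cg1 Cg2 Cg3
  Ca1 Ca2 Ca3 Ca4 Cb1 Cb2 Cb3 Cb4 Ef Eg Hx0 f0 f10 f20 f30 g0 g10 g20 g30 x Hx.
destruct (contI_bounded a1 Ca1) as [k1 [P1 B1]].
destruct (contI_bounded a2 Ca2) as [k2 [P2 B2]].
destruct (contI_bounded a3 Ca3) as [k3 [P3 B3]].
destruct (contI_bounded a4 Ca4) as [k4 [P4 B4]].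
destruct (contI_bounded b1 Cb1) as [l1 [Q1 D1]].
destruct (contI_bounded b2 Cb2) as [l2 [Q2 D2]].
destruct (contI_bounded b3 Cb3) as [l3 [Q3 D3]].
destruct (contI_bounded b4 Cb4) as [l4 [Q4 D4]].
set (F := fun z => f z ^ 2 + f1 z ^ 2 + f2 z ^ 2 + f3 z ^ 2
                 + (g z ^ 2 + g1 z ^ 2 + g2 z ^ 2 + g3 z ^ 2)).
assert (F x = 0) as EF.
{ apply (gronwall F
    (fun z => 2 * (f z * f1 z + f1 z * f2 z + f2 z * f3 z + f3 z * f4 z
                 + (g z * g1 z + g1 z * g2 z + g2 z * g3 z + g3 z * g4 z)))
    (* The 2 bounds the six products of consecutive derivatives; each coefficient contributes its
       own bound. *)
    (2 + (k1 + k2 + k3 + k4 + l1 + l2 + l3 + l4)) x0).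
  - unfold F; contI.
  - intros z Hz.
    evar_last.
    + unfold F; is_derive_sum_sq.
      * apply Df, Hz.
      * apply Df1, Hz.
      * apply Df2, Hz.
      * apply Df3, Hz.
      * apply Dg, Hz.
      * apply Dg1, Hz.
      * apply Dg2, Hz.
      * apply Dg3, Hz.
    + unfold plus; simpl; ring.
  - intros z Hz; pose proof (interior_I11 z Hz) as Iz.
    assert (T : forall u v : R, - (u ^ 2 + v ^ 2) <= 2 * (u * v) <= u ^ 2 + v ^ 2).
    { intros u v; pose proof (pow2_ge_0 (u + v)); pose proof (pow2_ge_0 (u - v)); split; lra. }
    assert (T' : forall u a K y, Rabs a <= K ->
      - (K * (u ^ 2 + y ^ 2)) <= 2 * (u * (a * y)) <= K * (u ^ 2 + y ^ 2)).
    { intros u a K y Ha; pose proof (abs_mult_le u a K y Ha) as L.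
      pose proof (Rle_abs (u * (a * y))).
      pose proof (Rle_abs (- (u * (a * y)))) as L'; rewrite Rabs_Ropp in L'; split; lra. }
    rewrite Ef, Eg by exact Hz.
    assert (G : forall K u v, 0 <= K -> u ^ 2 + v ^ 2 <= F z -> K * (u ^ 2 + v ^ 2) <= K * F z)
      by (intros; apply Rmult_le_compat_l; assumption).
    assert (N : forall w, 0 <= w ^ 2) by (intros; apply pow2_ge_0).
    pose proof (N (f z)); pose proof (N (f1 z)); pose proof (N (f2 z)); pose proof (N (f3 z)).
    pose proof (N (g z)); pose proof (N (g1 z)); pose proof (N (g2 z)); pose proof (N (g3 z)).
    pose proof (T (f z) (f1 z)); pose proof (T (f1 z) (f2 z)); pose proof (T (f2 z) (f3 z)).
    pose proof (T (g z) (g1 z)); pose proof (T (g1 z) (g2 z)); pose proof (T (g2 z) (g3 z)).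
    pose proof (T' (f3 z) (a1 z) k1 (f z) (B1 z Iz)).
    pose proof (T' (f3 z) (a2 z) k2 (g z) (B2 z Iz)).
    pose proof (T' (f3 z) (a3 z) k3 (f2 z) (B3 z Iz)).
    pose proof (T' (f3 z) (a4 z) k4 (g2 z) (B4 z Iz)).
    pose proof (T' (g3 z) (b1 z) l1 (f z) (D1 z Iz)).
    pose proof (T' (g3 z) (b2 z) l2 (g z) (D2 z Iz)).
    pose proof (T' (g3 z) (b3 z) l3 (f2 z) (D3 z Iz)).
    pose proof (T' (g3 z) (b4 z) l4 (g2 z) (D4 z Iz)).
    pose proof (G k1 (f3 z) (f z) P1 ltac:(unfold F; lra)).
    pose proof (G k2 (f3 z) (g z) P2 ltac:(unfold F; lra)).
    pose proof (G k3 (f3 z) (f2 z) P3 ltac:(unfold F; lra)).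
    pose proof (G k4 (f3 z) (g2 z) P4 ltac:(unfold F; lra)).
    pose proof (G l1 (g3 z) (f z) Q1 ltac:(unfold F; lra)).
    pose proof (G l2 (g3 z) (g z) Q2 ltac:(unfold F; lra)).
    pose proof (G l3 (g3 z) (f2 z) Q3 ltac:(unfold F; lra)).
    pose proof (G l4 (g3 z) (g2 z) Q4 ltac:(unfold F; lra)).
    assert (f z ^ 2 + f1 z ^ 2 + (f1 z ^ 2 + f2 z ^ 2) + (f2 z ^ 2 + f3 z ^ 2)
      + (g z ^ 2 + g1 z ^ 2 + (g1 z ^ 2 + g2 z ^ 2) + (g2 z ^ 2 + g3 z ^ 2)) <= 2 * F z)
      by (unfold F; lra).
    apply Rabs_le_between; split; lra.
  - intros z; unfold F.
    repeat apply Rplus_le_le_0_compat; apply pow2_ge_0.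
  - exact Hx0.
  - unfold F; rewrite f0, f10, f20, f30, g0, g10, g20, g30; ring.
  - exact Hx. }
unfold F in EF.
pose proof (pow2_ge_0 (f x)); pose proof (pow2_ge_0 (f1 x)); pose proof (pow2_ge_0 (f2 x)).
pose proof (pow2_ge_0 (f3 x)); pose proof (pow2_ge_0 (g x)); pose proof (pow2_ge_0 (g1 x)).
pose proof (pow2_ge_0 (g2 x)); pose proof (pow2_ge_0 (g3 x)).
split; apply Rsqr_0_uniq; unfold Rsqr; nra.
Qed.

Lemma derive_locally_zero (f f' : R -> R) x :
  (forall z, -1 < z < 1 -> is_derive f z (f' z)) -> -1 < x < 1 ->
  locally x (fun z => f z = 0) -> locally x (fun z => f' z = 0).
Proof.
intros D Hx H0.
generalize (filter_and _ _ (locally_interior x Hx) (locally_locally x _ H0)).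
apply filter_imp; intros y [Hy Ey].
rewrite <- (is_derive_unique f y (f' y)) by now apply D.
apply is_derive_unique, is_derive_ext_loc with (fun _ => 0).
- revert Ey; apply filter_imp; intros; now symmetry.
- apply is_derive_Reals, derivable_pt_lim_const.
Qed.

Lemma contI_locally_neq_0 w x :
  contI w -> -1 < x < 1 -> w x <> 0 -> locally x (fun z => w z <> 0).
Proof.
intros Cw Hx Hw.
assert (H : locally x (fun z => w (clamp z) <> 0)).
{ apply (Cw x (fun r => r <> 0)).
  apply open_neq; now rewrite clamp_id by now apply interior_I11. }
generalize (filter_and _ _ (locally_interior x Hx) H).
apply filter_imp; intros y [Hy Ey]; now rewrite clamp_id in Ey by now apply interior_I11.
Qed.

(** * The bound from the energy identity *)

(* Density of [{N <> 0}]. *)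
Definition separating (N : R -> R) : Prop :=
  forall w, contI w -> (forall x, -1 < x < 1 -> N x <> 0 -> w x = 0) ->
  forall x, I11 x -> w x = 0.

(** Suppose [k] is at least the bound. If [M2 / 2 <= b], both terms of the integrand are nonpositive
    and vanish identically, which is the excluded degenerate case. Otherwise Poincare's inequality
    absorbs the second term. [Rmax 0] joins the two signs, so that one statement serves both [U] and
    [-U]. *)
Lemma speed_bound (V DV D2V f f1 g g1 : R -> R) alpha b k M M2 :
  (forall z, -1 < z < 1 -> is_derive V z (DV z)) ->
  (forall z, -1 < z < 1 -> is_derive DV z (D2V z)) ->
  contI V -> contI D2V ->
  is_derive_on (V := R_NormedModule) I11 f f1 ->
  is_derive_on (V := R_NormedModule) I11 g g1 ->
  contI f1 -> contI g1 ->
  f (-1) = 0 -> f 1 = 0 -> f1 (-1) = 0 -> f1 1 = 0 ->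
  g (-1) = 0 -> g 1 = 0 -> g1 (-1) = 0 -> g1 1 = 0 ->
  alpha <> 0 -> (exists z, I11 z /\ f z ^ 2 + g z ^ 2 <> 0) ->
  separating (fun z => f z ^ 2 + g z ^ 2) ->
  (forall z, I11 z -> V z <= M) -> (forall z, I11 z -> D2V z <= M2) ->
  ~ ((exists k, forall z, I11 z -> V z = k) /\ b = 0) ->
  integralI (fun z =>
    (V z - k) * (f1 z ^ 2 + g1 z ^ 2 + alpha ^ 2 * (f z ^ 2 + g z ^ 2))
    + (D2V z / 2 - b) * (f z ^ 2 + g z ^ 2)) = 0 ->
  k < M + Rmax 0 (4 * (M2 / 2 - b) / (PI ^ 2 + 4 * alpha ^ 2)).
Proof.
intros DV1 DV2 CV CD2 Df Dg Cf1 Cg1 fm fp f1m f1p gm gp g1m g1p Ha Hnz Hsep HM HM2 Hnd HI.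
pose proof (is_derive_on_contI _ _ Df) as Cf.
pose proof (is_derive_on_contI _ _ Dg) as Cg.
assert (Ha2 : 0 < alpha ^ 2) by (apply pow2_gt_0, Ha).
assert (HQ : 0 < PI ^ 2 + 4 * alpha ^ 2) by (pose proof (pow2_ge_0 PI); lra).
apply Rnot_le_lt; intros Hk.
destruct (Rle_lt_dec (M2 / 2 - b) 0) as [Hb|Hb].
- assert (HkM : M <= k) by (pose proof (Rmax_l 0 (4 * (M2 / 2 - b) / (PI ^ 2 + 4 * alpha ^ 2))); lra).
  set (G := fun z => -1 * ((V z - k) * (f1 z ^ 2 + g1 z ^ 2 + alpha ^ 2 * (f z ^ 2 + g z ^ 2))
    + (D2V z / 2 - b) * (f z ^ 2 + g z ^ 2))).
  assert (CG : contI G) by (unfold G, Rdiv; contI).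
  assert (G0 : forall z, I11 z -> G z = 0).
  { intros z Hz; apply integralI_nonneg_eq_0; [exact CG| | |exact Hz].
    - intros y Hy; apply interior_I11 in Hy; unfold G.
      specialize (HM y Hy); specialize (HM2 y Hy).
      pose proof (pow2_ge_0 (f y)); pose proof (pow2_ge_0 (g y)).
      pose proof (pow2_ge_0 (f1 y)); pose proof (pow2_ge_0 (g1 y)).
      assert (0 <= (k - V y) * (f1 y ^ 2 + g1 y ^ 2 + alpha ^ 2 * (f y ^ 2 + g y ^ 2)))
        by (apply Rmult_le_pos; nra).
      assert (0 <= (b - D2V y / 2) * (f y ^ 2 + g y ^ 2)) by (apply Rmult_le_pos; lra).
      lra.
    - unfold G; rewrite integralI_scal by (contI); rewrite HI; lra. }
  (* [G] is a sum of two nonnegative products, and the factors [n] and [e] are positive here ([e]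
     since [alpha <> 0]). *)
  assert (Z : forall z, -1 < z < 1 -> f z ^ 2 + g z ^ 2 <> 0 -> V z - k = 0 /\ b - D2V z / 2 = 0).
  { intros z Hz Hn; apply interior_I11 in Hz.
    specialize (G0 z Hz); specialize (HM z Hz); specialize (HM2 z Hz); unfold G in G0.
    pose proof (pow2_ge_0 (f z)); pose proof (pow2_ge_0 (g z)).
    pose proof (pow2_ge_0 (f1 z)); pose proof (pow2_ge_0 (g1 z)).
    set (n := f z ^ 2 + g z ^ 2) in *.
    assert (Hn0 : 0 < n) by (unfold n in *; lra).
    set (e := f1 z ^ 2 + g1 z ^ 2 + alpha ^ 2 * n) in *.
    assert (He0 : 0 < e) by (unfold e; nra).
    assert (0 <= (k - V z) * e) by (apply Rmult_le_pos; lra).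
    assert (0 <= (b - D2V z / 2) * n) by (apply Rmult_le_pos; lra).
    split; [apply Rmult_eq_reg_r with e|apply Rmult_eq_reg_r with n]; lra. }
  assert (EV : forall z, I11 z -> V z - k = 0).
  { apply (Hsep (fun z => V z - k)); [contI|]; intros; now apply Z. }
  assert (ED : forall z, I11 z -> b - D2V z / 2 = 0).
  { apply (Hsep (fun z => b - D2V z / 2)); [contI|]; intros; now apply Z. }
  apply Hnd; split; [exists k; intros z Hz; specialize (EV z Hz); lra|].
  (* [V] is constant, so [D2V] vanishes at the interior point 0, and [b = D2V 0 / 2] is 0. *)
  assert (L0 : locally 0 (fun z => D2V z = 0)).
  { apply (derive_locally_zero DV); [exact DV2|lra|].
    apply (derive_locally_zero (fun z => V z - k)); [|lra|].
    - intros z Hz; evar_last.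
      + apply (is_derive_minus V (fun _ => k)); [now apply DV1|].
        apply is_derive_Reals, derivable_pt_lim_const.
      + unfold minus, plus, opp; simpl; ring.
    - generalize (locally_interior 0 ltac:(lra)).
      apply filter_imp; intros y Hy; now apply EV, interior_I11. }
  apply locally_singleton in L0.
  specialize (ED 0 ltac:(unfold I11; lra)); lra.
- set (r := 4 * (M2 / 2 - b) / (PI ^ 2 + 4 * alpha ^ 2)) in *.
  assert (Hr : 0 < r) by (apply Rdiv_lt_0_compat; lra).
  (* This choice of [r] bounds the integrand by [- r (pf + pg)]: the [alpha ^ 2] terms cancel and
     the Poincare integrands remain. *)
  assert (Er : M2 / 2 - b = r * ((PI / 2) ^ 2 + alpha ^ 2)) by (unfold r; field; lra).
  rewrite Rmax_right in Hk by lra.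
  destruct (poincare_strict f f1 Df Cf1 fm fp f1m f1p) as [Pf Zf].
  destruct (poincare_strict g g1 Dg Cg1 gm gp g1m g1p) as [Pg Zg].
  set (pf := fun z => f1 z ^ 2 - (PI / 2) ^ 2 * f z ^ 2) in *.
  set (pg := fun z => g1 z ^ 2 - (PI / 2) ^ 2 * g z ^ 2) in *.
  assert (Cpf : contI pf) by (unfold pf; contI).
  assert (Cpg : contI pg) by (unfold pg; contI).
  assert (L : 0 <= integralI (fun z => - r * (pf z + pg z))).
  { rewrite <- HI; apply integralI_le; [contI|contI|].
    intros z Hz; apply interior_I11 in Hz; unfold pf, pg.
    specialize (HM z Hz); specialize (HM2 z Hz).
    pose proof (pow2_ge_0 (f z)); pose proof (pow2_ge_0 (g z)).
    pose proof (pow2_ge_0 (f1 z)); pose proof (pow2_ge_0 (g1 z)).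
    set (n := f z ^ 2 + g z ^ 2) in *.
    set (e := f1 z ^ 2 + g1 z ^ 2 + alpha ^ 2 * n) in *.
    assert (0 <= n) by (unfold n; lra).
    assert (0 <= e) by (unfold e; nra).
    assert (0 <= (k - r - V z) * e) by (apply Rmult_le_pos; lra).
    assert (0 <= (r * ((PI / 2) ^ 2 + alpha ^ 2) - (D2V z / 2 - b)) * n)
      by (apply Rmult_le_pos; lra).
    apply Rle_trans with (- r * e + r * ((PI / 2) ^ 2 + alpha ^ 2) * n); [lra|].
    unfold e, n; lra. }
  rewrite integralI_scal, integralI_plus in L by contI.
  (* Both integrals are nonnegative and [- r] times their sum is nonnegative, so equality holds in
     Poincare's inequality and [f] and [g] vanish. *)
  assert (integralI pf <= 0 /\ integralI pg <= 0) as [If Ig] by (split; nra).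
  destruct Hnz as [z [Hz Hn]]; apply Hn.
  rewrite (Zf If z Hz), (Zg Ig z Hz); ring.
Qed.

(** * The Orr-Sommerfeld equation *)

(** Multiplying by [i alpha Rey] and solving for [p4] removes the complex division; the real and
    imaginary parts are then polynomial identities. *)
Lemma real_equations (c p p2 p4 : C) (u u2 alpha Rey beta : R) :
  alpha <> 0 -> 0 < Rey ->
  ((RtoC u - c) * (p2 - RtoC alpha ^ 2 * p) - RtoC (u2 - beta)%R * p
   = 1 / (Ci * RtoC alpha * RtoC Rey)
     * (p4 - 2 * RtoC alpha ^ 2 * p2 + RtoC alpha ^ 4 * p))%C ->
  Re p4 = 2 * alpha ^ 2 * Re p2 - alpha ^ 4 * Re p
    - alpha * Rey * ((u - Re c) * (Im p2 - alpha ^ 2 * Im p)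
                     - Im c * (Re p2 - alpha ^ 2 * Re p) - (u2 - beta) * Im p)
  /\
  Im p4 = 2 * alpha ^ 2 * Im p2 - alpha ^ 4 * Im p
    + alpha * Rey * ((u - Re c) * (Re p2 - alpha ^ 2 * Re p)
                     + Im c * (Im p2 - alpha ^ 2 * Im p) - (u2 - beta) * Re p).
Proof.
intros Ha HR Heq.
assert (HaC : RtoC alpha <> RtoC 0) by (intros E; apply Ha, RtoC_inj, E).
assert (HRC : RtoC Rey <> RtoC 0) by (intros E; apply RtoC_inj in E; lra).
assert (HiC : Ci <> RtoC 0) by (intros E; injection E; lra).
assert (E : p4 = (2 * RtoC alpha ^ 2 * p2 - RtoC alpha ^ 4 * p
  + Ci * RtoC alpha * RtoC Rey
    * ((RtoC u - c) * (p2 - RtoC alpha ^ 2 * p) - RtoC (u2 - beta)%R * p))%C).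
{ rewrite Heq; field; repeat split; assumption. }
rewrite E; clear.
destruct c as [cr ci], p as [f g], p2 as [f2 g2]; simpl; split; ring.
Qed.

(** In the real part of the equation times the conjugate of [phi], the [ci] and viscous terms are
    imaginary parts of products such as [phi''] by the conjugate of [phi], which are exact
    derivatives. Moving one derivative off [phi''] and then off [|phi|^2] turns [U''] into
    [U''/2]. *)
Lemma energy_identity (U U1 U2 f f1 f2 f3 f4 g g1 g2 g3 g4 : R -> R) alpha Rey beta cr ci :
  (forall z, -1 < z < 1 -> is_derive U z (U1 z)) ->
  (forall z, -1 < z < 1 -> is_derive U1 z (U2 z)) ->
  (forall z, -1 < z < 1 -> is_derive f z (f1 z)) ->
  (forall z, -1 < z < 1 -> is_derive f1 z (f2 z)) ->
  (forall z, -1 < z < 1 -> is_derive f2 z (f3 z)) ->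
  (forall z, -1 < z < 1 -> is_derive f3 z (f4 z)) ->
  (forall z, -1 < z < 1 -> is_derive g z (g1 z)) ->
  (forall z, -1 < z < 1 -> is_derive g1 z (g2 z)) ->
  (forall z, -1 < z < 1 -> is_derive g2 z (g3 z)) ->
  (forall z, -1 < z < 1 -> is_derive g3 z (g4 z)) ->
  contI U -> contI U1 -> contI U2 ->
  contI f -> contI f1 -> contI f2 -> contI f3 ->
  contI g -> contI g1 -> contI g2 -> contI g3 ->
  alpha <> 0 -> 0 < Rey ->
  f (-1) = 0 -> f 1 = 0 -> f1 (-1) = 0 -> f1 1 = 0 ->
  g (-1) = 0 -> g 1 = 0 -> g1 (-1) = 0 -> g1 1 = 0 ->
  (forall z, -1 < z < 1 -> f4 z = 2 * alpha ^ 2 * f2 z - alpha ^ 4 * f z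
    - alpha * Rey * ((U z - cr) * (g2 z - alpha ^ 2 * g z)
                     - ci * (f2 z - alpha ^ 2 * f z) - (U2 z - beta) * g z)) ->
  (forall z, -1 < z < 1 -> g4 z = 2 * alpha ^ 2 * g2 z - alpha ^ 4 * g z
    + alpha * Rey * ((U z - cr) * (f2 z - alpha ^ 2 * f z)
                     + ci * (g2 z - alpha ^ 2 * g z) - (U2 z - beta) * f z)) ->
  integralI (fun z =>
    (U z - cr) * (f1 z ^ 2 + g1 z ^ 2 + alpha ^ 2 * (f z ^ 2 + g z ^ 2))
    + (U2 z / 2 - beta) * (f z ^ 2 + g z ^ 2)) = 0.
Proof.
intros DU DU1 Df Df1 Df2 Df3 Dg Dg1 Dg2 Dg3 CU CU1 CU2 Cf Cf1 Cf2 Cf3 Cg Cg1 Cg2 Cg3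
  Ha HR fm fp f1m f1p gm gp g1m g1p Ef Eg.
(* [S] collects the boundary terms of the integrations by parts. *)
set (S := fun z => (U z - cr) * (f z * f1 z + g z * g1 z) - U1 z * (f z ^ 2 + g z ^ 2) * / 2
  + ci * (g1 z * f z - f1 z * g z)
  - / (alpha * Rey) * (g3 z * f z - f3 z * g z - (g2 z * f1 z - f2 z * g1 z)
                     - 2 * alpha ^ 2 * (g1 z * f z - f1 z * g z))).
rewrite (integralI_derive S).
- unfold S; rewrite fm, fp, f1m, f1p, gm, gp, g1m, g1p; ring.
- unfold S; contI.
- contI.
- intros z Hz.
  specialize (DU z Hz); specialize (DU1 z Hz).
  specialize (Df z Hz); specialize (Df1 z Hz); specialize (Df2 z Hz); specialize (Df3 z Hz).
  specialize (Dg z Hz); specialize (Dg1 z Hz); specialize (Dg2 z Hz); specialize (Dg3 z Hz).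
  unfold S; evar_last.
  + auto_derive; [repeat split; eexists; eassumption|reflexivity].
  + repeat match goal with |- context [Derive ?h z] => erewrite (is_derive_unique h z) by eassumption end.
    (* Eliminating [f4] and [g4] turns [S'] into the stated integrand. *)
    rewrite (Ef z Hz), (Eg z Hz); field; lra.
Qed.

(** If [w] is nonzero at an interior point, [f] and [g] vanish near it, hence so do their
    derivatives up to order three, and uniqueness makes [f] and [g] vanish everywhere. *)
Lemma ode_separating (U U2 f f1 f2 f3 f4 g g1 g2 g3 g4 : R -> R) alpha Rey beta cr ci :
  (forall z, -1 < z < 1 -> is_derive f z (f1 z)) ->
  (forall z, -1 < z < 1 -> is_derive f1 z (f2 z)) ->
  (forall z, -1 < z < 1 -> is_derive f2 z (f3 z)) ->
  (forall z, -1 < z < 1 -> is_derive f3 z (f4 z)) ->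
  (forall z, -1 < z < 1 -> is_derive g z (g1 z)) ->
  (forall z, -1 < z < 1 -> is_derive g1 z (g2 z)) ->
  (forall z, -1 < z < 1 -> is_derive g2 z (g3 z)) ->
  (forall z, -1 < z < 1 -> is_derive g3 z (g4 z)) ->
  contI U -> contI U2 ->
  contI f -> contI f1 -> contI f2 -> contI f3 ->
  contI g -> contI g1 -> contI g2 -> contI g3 ->
  (forall z, -1 < z < 1 -> f4 z = 2 * alpha ^ 2 * f2 z - alpha ^ 4 * f z
    - alpha * Rey * ((U z - cr) * (g2 z - alpha ^ 2 * g z)
                     - ci * (f2 z - alpha ^ 2 * f z) - (U2 z - beta) * g z)) ->
  (forall z, -1 < z < 1 -> g4 z = 2 * alpha ^ 2 * g2 z - alpha ^ 4 * g z
    + alpha * Rey * ((U z - cr) * (f2 z - alpha ^ 2 * f z)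
                     + ci * (g2 z - alpha ^ 2 * g z) - (U2 z - beta) * f z)) ->
  (exists z, I11 z /\ f z ^ 2 + g z ^ 2 <> 0) ->
  separating (fun z => f z ^ 2 + g z ^ 2).
Proof.
intros Df Df1 Df2 Df3 Dg Dg1 Dg2 Dg3 CU CU2 Cf Cf1 Cf2 Cf3 Cg Cg1 Cg2 Cg3 Ef Eg [z0 [Hz0 Hn]].
intros w Cw Hw.
assert (W : forall x, -1 < x < 1 -> w x = 0).
{ intros x Hx; destruct (Req_dec (w x) 0) as [E|E]; [exact E|exfalso].
  pose proof (filter_and _ _ (locally_interior x Hx) (contI_locally_neq_0 w x Cw Hx E)) as L.
  assert (Lfg : locally x (fun z => f z = 0 /\ g z = 0)).
  { revert L; apply filter_imp; intros z [Hz Hwz].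
    destruct (Req_dec (f z ^ 2 + g z ^ 2) 0) as [E0|E0]; [|now destruct Hwz; apply Hw].
    pose proof (pow2_ge_0 (f z)); pose proof (pow2_ge_0 (g z)).
    split; apply Rsqr_0_uniq; unfold Rsqr; lra. }
  assert (Lf : locally x (fun z => f z = 0)) by (revert Lfg; apply filter_imp; tauto).
  assert (Lg : locally x (fun z => g z = 0)) by (revert Lfg; apply filter_imp; tauto).
  pose proof (derive_locally_zero f f1 x Df Hx Lf) as Lf1.
  pose proof (derive_locally_zero f1 f2 x Df1 Hx Lf1) as Lf2.
  pose proof (derive_locally_zero f2 f3 x Df2 Hx Lf2) as Lf3.
  pose proof (derive_locally_zero g g1 x Dg Hx Lg) as Lg1.
  pose proof (derive_locally_zero g1 g2 x Dg1 Hx Lg1) as Lg2.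
  pose proof (derive_locally_zero g2 g3 x Dg2 Hx Lg2) as Lg3.
  apply Hn.
  (* The coefficients are those of [f], [g], [f2], [g2] in the two equations, in this order. *)
  destruct (linear_system_zero f f1 f2 f3 f4 g g1 g2 g3 g4
    (fun _ => - alpha ^ 4 - alpha * Rey * ci * alpha ^ 2)
    (fun z => alpha * Rey * ((U z - cr) * alpha ^ 2 + (U2 z - beta)))
    (fun _ => 2 * alpha ^ 2 + alpha * Rey * ci)
    (fun z => - (alpha * Rey * (U z - cr)))
    (fun z => - (alpha * Rey * ((U z - cr) * alpha ^ 2 + (U2 z - beta))))
    (fun _ => - alpha ^ 4 - alpha * Rey * ci * alpha ^ 2)
    (fun z => alpha * Rey * (U z - cr))
    (fun _ => 2 * alpha ^ 2 + alpha * Rey * ci) x) with (x := z0) as [-> ->];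
    try assumption; try contI.
  - intros z Hz; rewrite Ef by exact Hz; ring.
  - intros z Hz; rewrite Eg by exact Hz; ring.
  - now apply interior_I11.
  - exact (locally_singleton _ _ Lf).
  - exact (locally_singleton _ _ Lf1).
  - exact (locally_singleton _ _ Lf2).
  - exact (locally_singleton _ _ Lf3).
  - exact (locally_singleton _ _ Lg).
  - exact (locally_singleton _ _ Lg1).
  - exact (locally_singleton _ _ Lg2).
  - exact (locally_singleton _ _ Lg3).
  - ring. }
intros x Hx; now apply contI_zero_ends.
Qed.

Theorem theorem5
  (U DU D2U : R -> R)
  (HU1 : is_derive_on (V := R_NormedModule) I11 U DU)
  (HU2 : is_derive_on (V := R_NormedModule) I11 DU D2U)
  (HU2c : continuous_on I11 D2U)
  (alpha Rey beta : R) (Halpha : alpha <> 0) (HRey : 0 < Rey)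
  (c : C)
  (phi D1phi D2phi D3phi D4phi : R -> C)
  (Hphi1 : is_derive_on (V := C_R_NormedModule) I11 phi D1phi)
  (Hphi2 : is_derive_on (V := C_R_NormedModule) I11 D1phi D2phi)
  (Hphi3 : is_derive_on (V := C_R_NormedModule) I11 D2phi D3phi)
  (Hphi4 : is_derive_on (V := C_R_NormedModule) I11 D3phi D4phi)
  (Hphi_nz : exists z, I11 z /\ phi z <> RtoC 0)
  (Heq : forall z, I11 z ->
     ((RtoC (U z) - c) * (D2phi z - RtoC alpha ^ 2 * phi z)
        - RtoC (D2U z - beta)%R * phi z
      = 1 / (Ci * RtoC alpha * RtoC Rey)
        * (D4phi z - 2 * RtoC alpha ^ 2 * D2phi z + RtoC alpha ^ 4 * phi z))%C)
  (Hbc_phi : phi (-1) = RtoC 0 /\ phi 1 = RtoC 0)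
  (Hbc_Dphi : D1phi (-1) = RtoC 0 /\ D1phi 1 = RtoC 0)
  (Umin Umax D2Umin D2Umax : R)
  (HUmin : is_min_on I11 U Umin) (HUmax : is_max_on I11 U Umax)
  (HD2Umin : is_min_on I11 D2U D2Umin) (HD2Umax : is_max_on I11 D2U D2Umax)
  (* With U constant and beta = 0 every eigenvalue has c_r = U, so that the
     strict inequalities below fail. *)
  (Hnondeg : ~ ((exists k, forall z, I11 z -> U z = k) /\ beta = 0)) :
  (beta <= D2Umin / 2 ->
     Umin < Re c /\
     Re c < Umax + 4 * (D2Umax / 2 - beta) / (PI ^ 2 + 4 * alpha ^ 2))
  /\
  (D2Umin / 2 <= beta <= D2Umax / 2 ->
     Umin + 4 * (D2Umin / 2 - beta) / (PI ^ 2 + 4 * alpha ^ 2) < Re c /\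
     Re c < Umax + 4 * (D2Umax / 2 - beta) / (PI ^ 2 + 4 * alpha ^ 2))
  /\
  (D2Umax / 2 <= beta ->
     Umin + 4 * (D2Umin / 2 - beta) / (PI ^ 2 + 4 * alpha ^ 2) < Re c /\
     Re c < Umax).
Proof.
set (f := fun z => Re (phi z)); set (g := fun z => Im (phi z)).
set (f1 := fun z => Re (D1phi z)); set (g1 := fun z => Im (D1phi z)).
set (f2 := fun z => Re (D2phi z)); set (g2 := fun z => Im (D2phi z)).
set (f3 := fun z => Re (D3phi z)); set (g3 := fun z => Im (D3phi z)).
set (f4 := fun z => Re (D4phi z)); set (g4 := fun z => Im (D4phi z)).
pose proof (is_derive_on_Re _ _ Hphi1 : is_derive_on (V := R_NormedModule) I11 f f1) as Hf.
pose proof (is_derive_on_Re _ _ Hphi2 : is_derive_on (V := R_NormedModule) I11 f1 f2) as Hf1.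
pose proof (is_derive_on_Re _ _ Hphi3 : is_derive_on (V := R_NormedModule) I11 f2 f3) as Hf2.
pose proof (is_derive_on_Re _ _ Hphi4 : is_derive_on (V := R_NormedModule) I11 f3 f4) as Hf3.
pose proof (is_derive_on_Im _ _ Hphi1 : is_derive_on (V := R_NormedModule) I11 g g1) as Hg.
pose proof (is_derive_on_Im _ _ Hphi2 : is_derive_on (V := R_NormedModule) I11 g1 g2) as Hg1.
pose proof (is_derive_on_Im _ _ Hphi3 : is_derive_on (V := R_NormedModule) I11 g2 g3) as Hg2.
pose proof (is_derive_on_Im _ _ Hphi4 : is_derive_on (V := R_NormedModule) I11 g3 g4) as Hg3.
clear Hphi1 Hphi2 Hphi3 Hphi4.
pose proof (fun z => is_derive_on_interior U DU z HU1) as DU1.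
pose proof (fun z => is_derive_on_interior DU D2U z HU2) as DU2.
pose proof (fun z => is_derive_on_interior f f1 z Hf) as Df.
pose proof (fun z => is_derive_on_interior f1 f2 z Hf1) as Df1.
pose proof (fun z => is_derive_on_interior f2 f3 z Hf2) as Df2.
pose proof (fun z => is_derive_on_interior f3 f4 z Hf3) as Df3.
pose proof (fun z => is_derive_on_interior g g1 z Hg) as Dg.
pose proof (fun z => is_derive_on_interior g1 g2 z Hg1) as Dg1.
pose proof (fun z => is_derive_on_interior g2 g3 z Hg2) as Dg2.
pose proof (fun z => is_derive_on_interior g3 g4 z Hg3) as Dg3.
pose proof (is_derive_on_contI _ _ HU1) as CU.
pose proof (is_derive_on_contI _ _ HU2) as CU1.
pose proof (contI_of_continuous_on _ HU2c) as CU2.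
pose proof (is_derive_on_contI _ _ Hf) as Cf.
pose proof (is_derive_on_contI _ _ Hf1) as Cf1.
pose proof (is_derive_on_contI _ _ Hf2) as Cf2.
pose proof (is_derive_on_contI _ _ Hf3) as Cf3.
pose proof (is_derive_on_contI _ _ Hg) as Cg.
pose proof (is_derive_on_contI _ _ Hg1) as Cg1.
pose proof (is_derive_on_contI _ _ Hg2) as Cg2.
pose proof (is_derive_on_contI _ _ Hg3) as Cg3.
destruct Hbc_phi as [Pm Pp], Hbc_Dphi as [P1m P1p].
assert (fm : f (-1) = 0) by (unfold f; now rewrite Pm).
assert (fp : f 1 = 0) by (unfold f; now rewrite Pp).
assert (f1m : f1 (-1) = 0) by (unfold f1; now rewrite P1m).
assert (f1p : f1 1 = 0) by (unfold f1; now rewrite P1p).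
assert (gm : g (-1) = 0) by (unfold g; now rewrite Pm).
assert (gp : g 1 = 0) by (unfold g; now rewrite Pp).
assert (g1m : g1 (-1) = 0) by (unfold g1; now rewrite P1m).
assert (g1p : g1 1 = 0) by (unfold g1; now rewrite P1p).
assert (Nz : exists z, I11 z /\ f z ^ 2 + g z ^ 2 <> 0).
{ destruct Hphi_nz as [z [Hz Hn]]; exists z; split; [exact Hz|].
  intros E; apply Hn; unfold f, g in E.
  pose proof (pow2_ge_0 (Re (phi z))); pose proof (pow2_ge_0 (Im (phi z))).
  rewrite (surjective_pairing (phi z)).
  apply injective_projections; simpl; apply Rsqr_0_uniq; unfold Rsqr, Re, Im in *; lra. }
pose proof (fun z (Hz : -1 < z < 1) => real_equations c (phi z) (D2phi z) (D4phi z) (U z) (D2U z)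
  alpha Rey beta Halpha HRey (Heq z (interior_I11 z Hz))) as Eq.
pose proof (energy_identity U DU D2U f f1 f2 f3 f4 g g1 g2 g3 g4 alpha Rey beta (Re c) (Im c)
  DU1 DU2 Df Df1 Df2 Df3 Dg Dg1 Dg2 Dg3 CU CU1 CU2 Cf Cf1 Cf2 Cf3 Cg Cg1 Cg2 Cg3 Halpha HRey
  fm fp f1m f1p gm gp g1m g1p (fun z Hz => proj1 (Eq z Hz)) (fun z Hz => proj2 (Eq z Hz))) as HI.
pose proof (ode_separating U D2U f f1 f2 f3 f4 g g1 g2 g3 g4 alpha Rey beta (Re c) (Im c)
  Df Df1 Df2 Df3 Dg Dg1 Dg2 Dg3 CU CU2 Cf Cf1 Cf2 Cf3 Cg Cg1 Cg2 Cg3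
  (fun z Hz => proj1 (Eq z Hz)) (fun z Hz => proj2 (Eq z Hz)) Nz) as Sep.
assert (HQ : 0 < PI ^ 2 + 4 * alpha ^ 2).
{ pose proof (pow2_gt_0 alpha Halpha); pose proof (pow2_ge_0 PI); lra. }
assert (Upper : Re c < Umax + Rmax 0 (4 * (D2Umax / 2 - beta) / (PI ^ 2 + 4 * alpha ^ 2))).
{ apply (speed_bound U DU D2U f f1 g g1); try assumption; [apply HUmax|apply HD2Umax]. }
assert (Lower : - Re c < - Umin
    + Rmax 0 (4 * (- D2Umin / 2 - - beta) / (PI ^ 2 + 4 * alpha ^ 2))).
{ apply (speed_bound (fun z => - U z) (fun z => - DU z) (fun z => - D2U z) f f1 g g1);
    try assumption; try contI.
  - intros z Hz; apply (is_derive_opp U), DU1, Hz.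
  - intros z Hz; apply (is_derive_opp DU), DU2, Hz.
  - intros z Hz; destruct HUmin as [_ H]; specialize (H z Hz); lra.
  - intros z Hz; destruct HD2Umin as [_ H]; specialize (H z Hz); lra.
  - intros [[k Hk] Hb]; apply Hnondeg; split; [exists (- k); intros z Hz|]; [|lra].
    specialize (Hk z Hz); lra.
  - rewrite <- (Rmult_0_r (-1)), <- HI, <- integralI_scal by contI.
    apply integralI_ext; intros z _; field. }
(* Undoes the reflection, so that [Lower] speaks of the quotient in the theorem. *)
replace (4 * (- D2Umin / 2 - - beta) / (PI ^ 2 + 4 * alpha ^ 2))
  with (- (4 * (D2Umin / 2 - beta) / (PI ^ 2 + 4 * alpha ^ 2))) in Lower by (field; lra).
assert (Sgn : forall x, 0 <= x -> 0 <= 4 * x / (PI ^ 2 + 4 * alpha ^ 2)).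
{ intros x Hx; apply Rmult_le_pos; [lra|now apply Rlt_le, Rinv_0_lt_compat]. }
assert (Sgn' : forall x, x <= 0 -> 4 * x / (PI ^ 2 + 4 * alpha ^ 2) <= 0).
{ intros x Hx; specialize (Sgn (- x) ltac:(lra)).
  replace (4 * - x / (PI ^ 2 + 4 * alpha ^ 2)) with (- (4 * x / (PI ^ 2 + 4 * alpha ^ 2))) in Sgn
    by (field; lra); lra. }
(* This fixes the sign of [D2Umax / 2 - beta] in case (i) and of [D2Umin / 2 - beta] in case
   (iii). *)
assert (D2Umin <= D2Umax).
{ destruct HD2Umin as [[z [Hz <-]] _]; now apply HD2Umax. }
assert (Bmax : 0 <= D2Umax / 2 - beta ->
  Re c < Umax + 4 * (D2Umax / 2 - beta) / (PI ^ 2 + 4 * alpha ^ 2)).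
{ intros H0; rewrite Rmax_right in Upper by now apply Sgn.
  exact Upper. }
assert (Bmin : D2Umin / 2 - beta <= 0 ->
  Umin + 4 * (D2Umin / 2 - beta) / (PI ^ 2 + 4 * alpha ^ 2) < Re c).
{ intros H0; pose proof (Sgn' _ H0); rewrite Rmax_right in Lower by lra; lra. }
(* The sign of each quotient decides which argument [Rmax] selects; the bounds [Umin] in (i) and
   [Umax] in (iii) arise when it selects 0. *)
split; [|split]; intros Hb; split.
- pose proof (Sgn (D2Umin / 2 - beta) ltac:(lra)); rewrite Rmax_left in Lower by lra; lra.
- apply Bmax; lra.
- apply Bmin; lra.
- apply Bmax; lra.
- apply Bmin; lra.
- rewrite Rmax_left in Upper by (apply Sgn'; lra); lra.
Qed.
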